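(* Let $p$ be a prime and $q$ a power of $p$. Then $e_{q,p^{2}-p-1}$ divides $p$; that is, the element $b^{-q}a^{-q}(ab)^{q}$ has order dividing $p$ in $M(R(2,q;p^{2}-p-1))$.
   Context: $R(2,q;c)$ denotes the largest $2$-generator group of exponent $q$ and nilpotency class at most $c$, written $R(2,q;c)=F/R$ with $F$ free on $a,b$. The Schur multiplier is $M(G)=(R\cap F')/[F,R]$ (Hopf's formula). $e_{q,c}$ denotes the order of $b^{-q}a^{-q}(ab)^{q}[F,R]$ in $M(R(2,q;c))$. *)

(* Defs.v *)
From mathcomp Require Import all_boot.
Set Implicit Arguments. Unset Strict Implicit. Unset Printing Implicit Defensive.

(* A letter (g, e): g = false is the generator a, g = true is b;
   e = true means the inverse of that generator. *)
Definition letter := (bool * bool)%type.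
Definition flip (x : letter) : letter := (x.1, ~~ x.2).

Fixpoint reduced (s : seq letter) : bool :=
  match s with
  | x :: ((y :: _) as t) => (y != flip x) && reduced t
  | _ => true
  end.

Definition cons_red (x : letter) (t : seq letter) : seq letter :=
  match t with
  | y :: t' => if y == flip x then t' else x :: t
  | [::] => [:: x]
  end.

Definition reduce (s : seq letter) : seq letter := foldr cons_red [::] s.

Lemma reduced_cons_red x t : reduced t -> reduced (cons_red x t).
Proof.
case: t => [|y t] //= Ht.
case: ifP => Hy.
  by case: t Ht => [|z t] //= /andP [].
by rewrite /= Hy.
Qed.

Lemma reduced_reduce s : reduced (reduce s).
Proof. by elim: s => [|x s IH] //=; apply: reduced_cons_red. Qed.

Definition FG := {s : seq letter | reduced s}.

Definition fg_one : FG := exist _ [::] isT.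
Definition fg_mul (x y : FG) : FG :=
  exist _ (reduce (proj1_sig x ++ proj1_sig y)) (reduced_reduce _).
Definition fg_inv (x : FG) : FG :=
  exist _ (reduce (rev (map flip (proj1_sig x)))) (reduced_reduce _).
Definition fg_pow (x : FG) (n : nat) : FG := iter n (fg_mul x) fg_one.

Definition gen_a : FG := exist _ [:: (false, false)] isT.
Definition gen_b : FG := exist _ [:: (true, false)] isT.

Definition fg_comm (x y : FG) : FG :=
  fg_mul (fg_mul (fg_inv x) (fg_inv y)) (fg_mul x y).

Inductive gen (S : FG -> Prop) : FG -> Prop :=
  | gen_base x : S x -> gen S x
  | gen_one : gen S fg_one
  | gen_inv x : gen S x -> gen S (fg_inv x)
  | gen_mul x y : gen S x -> gen S y -> gen S (fg_mul x y).

Definition fullF : FG -> Prop := fun _ => True.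

Definition commsub (H K : FG -> Prop) : FG -> Prop :=
  gen (fun z => exists h k, H h /\ K k /\ z = fg_comm h k).

(* lower central series: lcs n = gamma_{n+1}(F); lcs 0 = F *)
Fixpoint lcs (n : nat) : FG -> Prop :=
  match n with
  | 0 => fullF
  | n'.+1 => commsub (lcs n') fullF
  end.

(* R = F^q gamma_{c+1}(F), so that F / R = R(2,q;c) *)
Definition Rrel (q c : nat) : FG -> Prop :=
  gen (fun z => (exists x, z = fg_pow x q) \/ lcs c z).

Definition derF : FG -> Prop := commsub fullF fullF.

Definition w_elt (q : nat) : FG :=
  fg_mul (fg_mul (fg_inv (fg_pow gen_b q)) (fg_inv (fg_pow gen_a q)))
         (fg_pow (fg_mul gen_a gen_b) q).

(* Main.v *)
From HB Require Import structures.
Require Import Defs.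
From mathcomp Require Import all_boot.
Set Implicit Arguments. Unset Strict Implicit. Unset Printing Implicit Defensive.

(** Put N = [F, R]. Modulo N all q-th powers are central and F has class at most
    p^2 - p. The Hall-Petrescu formula
      (xy)^n = x^n y^n c_2^C(n,2) ... c_n^C(n,n),   c_i in gamma_i(<x, y>),
    applied to [u^n, y] = u^-n (u [u, y])^n, gives by downward induction on k
    - gamma_k(F)^q <= N for k >= p, because the factors with i >= p have weight
      more than p (p - 1) and q divides C(q, i) for 0 < i < p;
    - gamma_k(F)^(pq) <= N for k >= 2, because pq divides C(pq, i) for 0 < i < p
      while q divides C(pq, i) for p <= i < p^2.
    The formula for (ab)^(pq) then reads (ab)^(pq) = a^(pq) b^(pq) modulo N, and
    centrality of the q-th powers turns this into w^p in N.

    The Hall-Petrescu formula is obtained from the Lazard-Leibman theorem: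
    sequences whose iterated discrete derivatives of order i lie in the i-th
    term of a filtration form a group; n |-> y^-n x^-n (xy)^n is one of them, and
    the c_i are its Taylor coefficients. *)

Local Open Scope group_scope.

(** * Polynomial sequences in a filtered group *)

Ltac group_word :=
  rewrite ?conjgE ?commgEl ?conjgE;
  rewrite ?(invgM, invgK, invg1, mulg1, mul1g) -?mulgA;
  rewrite ?(mulKg, mulVKg, mulgV, mulVg, mulg1, mul1g).

Record is_subgroup (G : groupType) (H : G -> Prop) : Prop := IsSubgroup {
  sub1 : H 1;
  subM : forall x y, H x -> H y -> H (x * y);
  subV : forall x, H x -> H x^-1 }.

Record is_filtration (G : groupType) (F : nat -> G -> Prop) : Prop :=
  IsFiltration {
  filt_sub : forall i, is_subgroup (F i);
  filt_anti : forall i x, F i.+1 x -> F i x;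
  filt_comm : forall i j x y, F i x -> F j y -> F (i + j) [~ x, y] }.

Lemma subX (G : groupType) (H : G -> Prop) (x : G) n :
  is_subgroup H -> H x -> H (x ^+ n).
Proof.
move=> sH Hx; elim: n => [|n IH]; first by rewrite expg0; apply: sub1.
by rewrite expgS; apply: subM.
Qed.

Section PolynomialSequences.

Variables (G : groupType) (F : nat -> G -> Prop).
Hypothesis filtF : is_filtration F.
Implicit Types (g h : nat -> G).

(* Both one-sided derivatives are imposed at each step: this makes closure under
   inverses immediate. *)
Definition rderiv g n := g n.+1 * (g n)^-1.
Definition lderiv g n := (g n)^-1 * g n.+1.

Fixpoint poly_seq k j g : Prop :=
  (forall n, F j (g n)) /\
  (if k is k'.+1 then poly_seq k' j.+1 (rderiv g) /\ poly_seq k' j.+1 (lderiv g)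
   else True).

Lemma poly_seq_val k j g n : poly_seq k j g -> F j (g n).
Proof. by case: k => [|k] []. Qed.

Lemma eq_poly_seq k j g h : g =1 h -> poly_seq k j g -> poly_seq k j h.
Proof.
elim: k j g h => [|k IH] j g h e /= [Fg].
  by move=> _; split=> // n; rewrite -e.
move=> [Dr Dl]; split=> [n|]; first by rewrite -e.
by split; [apply: IH Dr | apply: IH Dl] => n; rewrite /rderiv /lderiv !e.
Qed.

Lemma poly_seqV k j g : poly_seq k j g -> poly_seq k j (fun n => (g n)^-1).
Proof.
elim: k j g => [|k IH] j g /= [Fg].
  by split=> // n; apply: (subV (filt_sub filtF j)).
move=> [Dr Dl]; split=> [n|]; first exact: (subV (filt_sub filtF j)).
by split; [apply: eq_poly_seq (IH _ _ Dl) | apply: eq_poly_seq (IH _ _ Dr)] => n;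
   rewrite /rderiv /lderiv; group_word.
Qed.

(** By Pascal's rule both derivatives of n |-> x^C(n, m+1) are n |-> x^C(n, m): each derivative
    lowers the binomial index as it raises the filtration index. *)
Lemma poly_seqX k j x m :
  F (j + m) x -> poly_seq k j (fun n => x ^+ 'C(n, m)).
Proof.
have anti i l y : F (i + l) y -> F i y.
  elim: l => [|l IH]; first by rewrite addn0.
  by rewrite addnS => /(filt_anti filtF).
have P1 k' i : poly_seq k' i (fun=> 1).
  elim: k' i => [|k' IH] i /=; first by split=> // _; apply: (sub1 (filt_sub filtF i)).
  split=> [_|]; first exact: (sub1 (filt_sub filtF i)).
  by split; apply: eq_poly_seq (IH _) => n; rewrite /rderiv /lderiv; group_word.
elim: k j m x => [|k IH] j m x Fx /=; have Fjx := anti _ _ _ Fx.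
  by split=> // n; apply: subX Fjx; apply: filt_sub.
split=> [n|]; first by apply: subX Fjx; apply: filt_sub.
case: m Fx => [|m] Fx.
  by split; apply: eq_poly_seq (P1 _ _) => n; rewrite /rderiv /lderiv !bin0; group_word.
rewrite addnS -addSn in Fx.
split; apply: eq_poly_seq (IH _ _ _ Fx) => n; rewrite /rderiv /lderiv binS.
  by rewrite addnC expgnDr mulgK.
by rewrite expgnDr mulKg.
Qed.

(** * The Lazard-Leibman theorem *)

Section Truncated.

Variable M : nat.

(** Derivatives are tested only up to filtration index [M]. For [i >= M] only values matter, which
    starts the downward induction. *)
Let P i := poly_seq (M - i) i.

(** Level [i] tests one more derivative than level [i.+1]; that derivative is a quotient of elements
    already known to lie in the required subgroup. *)
Lemma polyS i g : P i.+1 g -> P i g.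
Proof.
rewrite /P; case: (ltnP i M) => [iM|Mi]; last first.
  have -> : M - i = 0 by apply/eqP; rewrite subn_eq0.
  have -> : M - i.+1 = 0 by apply/eqP; rewrite subn_eq0 leqW.
  by move=> [Fg _]; split=> // n; apply: (filt_anti filtF).
rewrite -(subnSK iM); move: (M - i.+1) => k {iM}.
elim: k i g => [|k IH] i g /=.
  move=> [Fg _]; split=> [n|]; first exact: (filt_anti filtF).
  have sF := filt_sub filtF i.+1.
  by split; split=> // n; apply: (subM sF) => //; apply: (subV sF).
move=> [Fg [Dr Dl]]; split=> [n|]; first exact: (filt_anti filtF).
by split; apply: IH.
Qed.

Lemma poly0 i g : P i g -> P 0 g.
Proof. by elim: i => // i IH /polyS. Qed.

(* Each half at level m needs both halves at level m.+1, hence the joint downward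
   induction. *)
Let good m := (forall g h, P m g -> P m h -> P m (fun n => g n * h n)) /\
  (forall i j g h, i + j = m -> P i g -> P j h -> P m (fun n => [~ g n, h n])).

Lemma goodJ m g h : good m -> P m g -> P 0 h -> P m (fun n => g n ^ h n).
Proof.
move=> [gM gR] Pg Ph.
have PR : P m (fun n => [~ g n, h n]) by apply: (gR m 0) => //; rewrite addn0.
by apply: eq_poly_seq (gM _ _ Pg PR) => n; rewrite commgEl mulVKg.
Qed.

Lemma good_geM m : M <= m -> good m.
Proof.
rewrite -subn_eq0 => /eqP Mm; rewrite /good /P Mm; split=> [g h [Fg _] [Fh _]|].
  by split=> // n; apply: (subM (filt_sub filtF m)).
move=> i j g h <- Pg Ph; split=> // n.
by apply: (filt_comm filtF); [apply: poly_seq_val Pg | apply: poly_seq_val Ph].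
Qed.

Lemma polyE i g : i < M ->
  P i g <-> [/\ forall n, F i (g n), P i.+1 (rderiv g) & P i.+1 (lderiv g)].
Proof.
move=> iM; rewrite /P -(subnSK iM) /=; split; first by case=> ? [].
by case.
Qed.

Lemma good_pred m : m < M -> good m.+1 -> good m.
Proof.
move=> mM IH; have [gM gR] := IH.
have sF := filt_sub filtF.
split=> [g h Pg Ph|i j g h ijm Pg Ph].
  have P0g := poly0 Pg; have P0h := poly0 Ph.
  have /polyE-/(_ mM) [Fg Dg Dg'] := Pg; have /polyE-/(_ mM) [Fh Dh Dh'] := Ph.
  apply/polyE => //; split=> [n||]; first exact: (subM (sF m)).
    apply: eq_poly_seq (gM _ _ Dg (goodJ IH Dh (poly_seqV P0g))) => n.
    by rewrite /rderiv; group_word.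
  apply: eq_poly_seq (gM _ _ (goodJ IH Dg' P0h) Dh') => n.
  by rewrite /lderiv; group_word.
have iM : i < M by apply: leq_ltn_trans mM; rewrite -ijm leq_addr.
have jM : j < M by apply: leq_ltn_trans mM; rewrite -ijm leq_addl.
have P0g := poly0 Pg; have P0h := poly0 Ph.
have /polyE-/(_ iM) [Fg Dg Dg'] := Pg; have /polyE-/(_ jM) [Fh Dh Dh'] := Ph.
(* Writing g(n+1) = g' g and h(n+1) = h' h, the derivative of [g, h] is a product of conjugates of
   [g', h], [g', h'] and [g^-1, h'^-1], all of level [m.+1]. *)
have dh : P m.+1 (fun n => [~ rderiv g n, h n]).
  by apply: (gR i.+1 j) => //; rewrite addSn ijm.
have de : P m.+1 (fun n => [~ rderiv g n, rderiv h n]).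
  by apply: (gR i.+1 j) => //; [rewrite addSn ijm | apply: polyS].
have ge : P m.+1 (fun n => [~ (g n)^-1, (rderiv h n)^-1]).
  by apply: (gR i j.+1); [rewrite addnS ijm | apply: poly_seqV ..].
have X := gM _ _ de (goodJ IH ge (poly0 Dh)).
have {}X := goodJ IH (gM _ _ dh (goodJ IH X P0h)) P0g.
have DR : P m.+1 (rderiv (fun n => [~ g n, h n])).
  by apply: eq_poly_seq X => n; rewrite /rderiv; group_word.
apply/polyE => //; split=> [n|//|]; first by rewrite -ijm; apply: (filt_comm filtF).
(* The left derivative is the right one conjugated by [g, h]. The conjugation goes factor by factor,
   since closure of [P 0] under products is not yet available. *)
have Y := goodJ IH (goodJ IH DR (poly_seqV P0g)) (poly_seqV P0h).
apply: eq_poly_seq (goodJ IH (goodJ IH Y P0g) P0h) => n.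
by rewrite /rderiv /lderiv; group_word.
Qed.

Lemma poly_seqM g h : P 0 g -> P 0 h -> P 0 (fun n => g n * h n).
Proof.
suff [gM _] : good 0 by apply: gM.
have [d le] : exists d, M <= 0 + d by exists M.
elim: d 0 le => [|d IH] m; first by rewrite addn0 => /good_geM.
case: (leqP M m) => [/good_geM //|mM]; rewrite addnS -addSn => /IH.
exact: good_pred.
Qed.

End Truncated.

(** If g vanishes below n, then g(n) is its n-th discrete derivative at 0. *)
Lemma poly_seq_first k j g n : n <= k ->
  poly_seq k j g -> (forall i, i < n -> g i = 1) -> F (j + n) (g n).
Proof.
elim: n k j g => [|n IH] k j g; first by rewrite addn0 => _ /(poly_seq_val 0).
case: k => // k; rewrite ltnS => nk [_ [Dr _]] g1.
rewrite addnS -addSn; suff -> : g n.+1 = rderiv g n.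
  apply: IH Dr _ => // i lin; rewrite /rderiv !g1 ?invg1 ?mulg1 //.
  exact: ltnW.
by rewrite /rderiv (g1 n) // invg1 mulg1.
Qed.

(* The Hall-Petrescu formula; the coefficients c_i are divided out one at a
   time, so that only their powers modulo N have to be recorded. *)
Lemma Hall_Petrescu_mem (N : G -> Prop) (x y : G) n :
  is_subgroup N -> F 1 x -> F 1 y ->
  (forall i c, 1 < i <= n -> F i c -> N (c ^+ 'C(n, i))) ->
  N ((y ^+ n)^-1 * (x ^+ n)^-1 * (x * y) ^+ n).
Proof.
move=> sN Fx Fy HN.
pose g m := (y ^+ m)^-1 * (x ^+ m)^-1 * (x * y) ^+ m.
have PX z : F 1 z -> poly_seq (n - 0) 0 (fun m => z ^+ m).
  by move=> Fz; apply: eq_poly_seq (poly_seqX _ (Fz : F (0 + 1) z)) => m; rewrite bin1.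
have Pg : poly_seq (n - 0) 0 g.
  apply: poly_seqM; last by apply: PX; apply: (subM (filt_sub filtF 1)).
  by apply: poly_seqM; apply: poly_seqV; apply: PX.
have g1 i : i < 2 -> g i = 1.
  by case: i => [|[]] // _; rewrite /g ?expg0 ?expg1; group_word.
(* Here h is what remains once the coefficients of index below s are divided out; its next
   coefficient is then h(s). *)
suff clear d s h : s + d = n.+1 -> 1 < s -> poly_seq (n - 0) 0 h ->
    (forall i, i < s -> h i = 1) -> N (h n).
  case: (ltnP n 2) => [/g1|n2]; first by rewrite /g => ->; apply: sub1.
  by apply: (clear n.-1 2 g) => //; rewrite add2n prednK // ltnW.
elim: d s h => [|d IH] s h.
  by rewrite addn0 => -> _ _ -> //; apply: (sub1 sN).
rewrite addnS => -[sdn] s1 Ph h1.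
have sn : s <= n by rewrite -sdn leq_addr.
have Fc : F s (h s).
  by rewrite -[s]add0n; apply: poly_seq_first Ph h1; rewrite subn0.
have -> : h n = (h s) ^+ 'C(n, s) * ((h s)^-1 ^+ 'C(n, s) * h n).
  by rewrite expVgn mulVKg.
apply: (subM sN); first by apply: HN => //; rewrite s1.
apply: (IH s.+1 (fun m => (h s)^-1 ^+ 'C(m, s) * h m)).
- by rewrite addSn sdn.
- exact: ltnW.
- apply: poly_seqM Ph; apply: poly_seqX; rewrite add0n.
  exact: (subV (filt_sub filtF s)).
move=> i; rewrite ltnS leq_eqVlt => /predU1P [->|lis].
  by rewrite binn expg1 mulVg.
by rewrite bin_small // expg0 mul1g h1.
Qed.

End PolynomialSequences.
(** * The free group of rank two *)

Lemma flipK : involutive flip.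
Proof. by case=> g e; rewrite /flip /= negbK. Qed.

Lemma cons_red_flipK x t : reduced t -> cons_red x (cons_red (flip x) t) = t.
Proof.
case: t => [|y t] /=; first by rewrite eqxx.
rewrite flipK; case: eqP => [->|yx]; last by rewrite /= eqxx.
by case: t => [|z t] //= /andP [/negPf -> _].
Qed.

Lemma reduce_id s : reduced s -> reduce s = s.
Proof.
elim: s => [|x s IH] // rs /=; rewrite -/(reduce s) IH.
  by case: s rs {IH} => [|y s] //= /andP [/negPf ->].
by case: s rs {IH} => [|y s] //= /andP [].
Qed.

Lemma reduced_foldr s t : reduced t -> reduced (foldr cons_red t s).
Proof. by move=> rt; elim: s => //= x s; apply: reduced_cons_red. Qed.

(** Letters act on reduced words through [cons_red], with [flip] acting as the inverse, so a word
    and its reduction act alike. Associativity follows. *)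
Lemma foldr_reduce s t :
  reduced t -> foldr cons_red t (reduce s) = foldr cons_red t s.
Proof.
move=> rt; elim: s => //= x s <-; rewrite -/(reduce s).
case: (reduce s) => //= y u; case: eqP => //= ->.
by rewrite cons_red_flipK // reduced_foldr.
Qed.

Lemma fg_mulA : associative fg_mul.
Proof.
move=> [x rx] [y ry] [z rz]; apply: val_inj => /=.
rewrite /reduce foldr_cat -/(reduce _) (reduce_id (reduced_reduce _)).
rewrite [RHS]foldr_cat -/(reduce z) (reduce_id rz) [RHS]foldr_reduce //.
by rewrite /reduce !foldr_cat -/(reduce z) reduce_id.
Qed.

Lemma fg_mul1 : left_id fg_one fg_mul.
Proof. by move=> [x rx]; apply: val_inj; rewrite /= reduce_id. Qed.

Lemma fg_mulr1 : right_id fg_one fg_mul.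
Proof. by move=> [x rx]; apply: val_inj; rewrite /= cats0 reduce_id. Qed.

Lemma fg_mulV : left_inverse fg_one fg_inv fg_mul.
Proof.
move=> [x rx]; apply: val_inj => /=; rewrite /reduce foldr_cat -/(reduce x).
rewrite -/(reduce (rev _)) reduce_id // foldr_reduce //.
elim: x rx => //= x s IH rs; rewrite rev_cons foldr_rcons /= flipK eqxx IH //.
by case: s rs {IH} => [|y s] //= /andP [].
Qed.

Lemma fg_mulVr : right_inverse fg_one fg_inv fg_mul.
Proof.
move=> [x rx]; apply: val_inj => /=; rewrite /reduce foldr_cat.
rewrite -/(reduce (rev _)) -/(reduce (reduce _)) (reduce_id (reduced_reduce _)).
(* The empty word is generalised to any reduced [t], because the induction changes the word acted
   upon. *)
rewrite /reduce; move: (isT : reduced [::]); move: [::] => t.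
elim: x t {rx} => //= x s IH t rt.
by rewrite rev_cons foldr_rcons IH ?cons_red_flipK // reduced_cons_red.
Qed.

HB.instance Definition _ := Choice.copy FG {s : seq letter | reduced s}.
HB.instance Definition _ :=
  isGroup.Build FG fg_mulA fg_mul1 fg_mulr1 fg_mulV fg_mulVr.

Implicit Types (x y z u v w : FG) (H K N : FG -> Prop).

Lemma fg_commE x y : fg_comm x y = [~ x, y].
Proof. by rewrite commgEl conjgE mulgA. Qed.

Lemma fg_powE x n : fg_pow x n = x ^+ n.
Proof. exact: iter_mulg_1. Qed.

(** * Normal subgroups and commutator subgroups *)

Lemma gen_sub (S : FG -> Prop) : is_subgroup (gen S).
Proof. by split; [apply: gen_one | apply: gen_mul | apply: gen_inv]. Qed.

Lemma gen_min (S H : FG -> Prop) :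
  is_subgroup H -> (forall x, S x -> H x) -> forall x, gen S x -> H x.
Proof.
move=> sH SH x; elim=> {x} [||x _ Hx|x y _ Hx _ Hy].
- exact: SH.
- exact: (sub1 sH).
- exact: (subV sH).
- exact: (subM sH).
Qed.

Record is_normal N : Prop := IsNormal {
  normal_sub : is_subgroup N;
  normalJ : forall x y, N x -> N (x ^ y) }.

Lemma normalR N x y : is_normal N -> N x -> N [~ x, y].
Proof.
move=> [sN nN] Nx; rewrite commgEl; apply: (subM sN); last exact: nN.
exact: (subV sN).
Qed.

Lemma commN N x y : is_subgroup N -> N [~ x, y] -> N [~ y, x].
Proof. by move=> sN Nxy; rewrite -invgR; apply: (subV sN). Qed.

(** This is the preimage of the centralizer of x in F/N; it reduces commutation modulo N to
    generators. *)
Lemma comm_centralizer_sub N x :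
  is_normal N -> is_subgroup (fun y => N [~ x, y]).
Proof.
move=> [sN nN]; split=> [|y z Ny Nz|y Ny].
- by rewrite commg1; apply: (sub1 sN).
- have -> : [~ x, y * z] = [~ x, z] * [~ x, y] ^ z by group_word.
  by apply: (subM sN) => //; apply: nN.
have -> : [~ x, y^-1] = ([~ x, y] ^ y^-1)^-1 by group_word.
by apply: (subV sN); apply: nN.
Qed.

Lemma comm_gen_mem N (S T : FG -> Prop) x y : is_normal N ->
  (forall s t, S s -> T t -> N [~ s, t]) -> gen S x -> gen T y -> N [~ x, y].
Proof.
move=> nN ST Sx; apply: gen_min (comm_centralizer_sub x nN) _ _ => t Tt.
apply: (commN (normal_sub nN)).
apply: gen_min (comm_centralizer_sub t nN) _ _ Sx => s Ss.
by apply: (commN (normal_sub nN)); apply: ST.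
Qed.

Lemma commsub_normal H K :
  (forall x y, H x -> H (x ^ y)) -> (forall x y, K x -> K (x ^ y)) ->
  is_normal (commsub H K).
Proof.
move=> nH nK; split=> [|x y]; first exact: gen_sub.
elim=> {x} [x [h [k [Hh [Kk ->]]]]||x _ IH|x z _ IHx _ IHz].
- apply: gen_base; exists (h ^ y), (k ^ y); split; first exact: nH.
  by split; [apply: nK | rewrite !fg_commE conjRg].
- by rewrite conj1g; apply: gen_one.
- by rewrite conjVg; apply: gen_inv.
by rewrite conjMg; apply: gen_mul.
Qed.

Lemma commsub_mem H K x y : H x -> K y -> commsub H K [~ x, y].
Proof. by move=> Hx Ky; apply: gen_base; exists x, y; rewrite fg_commE. Qed.

(** * The lower central series *)

Lemma lcs_normal n : is_normal (lcs n).
Proof.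
elim: n => [|n IH]; first by split.
by apply: commsub_normal => //; apply: normalJ.
Qed.

Lemma lcs_sub n : is_subgroup (lcs n).
Proof. exact: normal_sub (lcs_normal n). Qed.

Lemma lcs_commr n x y : lcs n x -> lcs n.+1 [~ x, y].
Proof. by move=> nx; apply: commsub_mem. Qed.

Lemma lcsS n x : lcs n.+1 x -> lcs n x.
Proof.
apply: gen_min (lcs_sub n) _ _ => _ [h [k [nh [_ ->]]]].
by rewrite fg_commE; apply: normalR => //; apply: lcs_normal.
Qed.

Lemma lcs_le m n x : m <= n -> lcs n x -> lcs m x.
Proof.
by move=> /subnK <-; elim: (n - m) => // d IH; rewrite addSn => /lcsS.
Qed.

(* By the Hall-Witt identity. *)
Lemma lcs_comm i j x y : lcs i x -> lcs j y -> lcs (i + j).+1 [~ x, y].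
Proof.
elim: j i x y => [|j IH] i x y ix jy; first by rewrite addn0; apply: lcs_commr.
rewrite addnS; have [sN nN] := lcs_normal (i + j).+2.
move: jy; apply: gen_min (comm_centralizer_sub x (lcs_normal _)) _ _.
move=> _ [h [k [jh [_ ->]]]]; rewrite fg_commE.
have -> : [~ x, [~ h, k]] =
  ([~ [~ k^-1, x^-1], h] ^ x * [~ [~ x, h^-1], k^-1] ^ h) ^ k by group_word.
apply: (nN); apply: (subM sN); apply: nN.
  rewrite -addSn; apply: IH => //; apply: (commN (lcs_sub _)).
  by apply: lcs_commr; apply: (subV (lcs_sub i)).
by apply: lcs_commr; apply: IH => //; apply: (subV (lcs_sub j)).
Qed.

(** The shift makes the i-th term gamma_i, with both terms 0 and 1 equal to F. *)
Lemma lcs_filtration : is_filtration (fun i => lcs i.-1).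
Proof.
split=> [i|[|i] x|i j x y ix jy]; first exact: lcs_sub; first by [].
  exact: lcsS.
case: i ix => [|i] ix.
  by apply: (commN (lcs_sub _)); apply: normalR => //; apply: lcs_normal.
case: j jy => [|j] jy; last by rewrite addSn addnS; apply: lcs_comm.
by rewrite addn0; apply: normalR => //; apply: lcs_normal.
Qed.

(* The i-th term has weight i * k + 1 rather than only i * k, since commutators
   of [u] with itself vanish. *)
Definition power_filtration k u i : FG -> Prop :=
  if i < 2 then gen (fun z => z = u \/ lcs k z) else lcs (i * k).

Lemma power_filtrationP k u :
  0 < k -> lcs k.-1 u -> is_filtration (power_filtration k u).
Proof.
move=> k0 ku; pose S z := z = u \/ lcs k z.
have HS x : gen S x -> lcs k.-1 x.
  apply: gen_min (lcs_sub _) _ _ => z [-> //|].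
  by apply: lcs_le; apply: leq_pred.
have LH i x : 0 < i -> lcs (i * k) x -> gen S x.
  by move=> i0 ix; apply: gen_base; right; apply: lcs_le ix; rewrite leq_pmull.
have HL x y j : gen S x -> lcs (j * k) y -> lcs (j.+1 * k) [~ x, y].
  move=> /HS kx jy; have := lcs_comm kx jy.
  by rewrite -addSn prednK // mulSn.
(* On generators, [u, u] = 1, and every other pair has a member in [lcs (1 * k)], to which [HL]
   applies. *)
have HH x y : gen S x -> gen S y -> lcs (2 * k) [~ x, y].
  apply: comm_gen_mem (lcs_normal _) _ => s t Ss [->|kt]; last first.
    by rewrite -[k]mul1n in kt; apply: HL => //; apply: gen_base.
  case: Ss => [->|ks]; first by rewrite commgg; apply: (sub1 (lcs_sub _)).
  apply: (commN (lcs_sub _)); rewrite -[k]mul1n in ks; apply: HL => //.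
  by apply: gen_base; left.
split=> [i|i x|i j x y]; rewrite /power_filtration.
- by case: ifP => _; [apply: gen_sub | apply: lcs_sub].
- case: i => [|[|i]] //=; first by apply: LH.
  by apply: lcs_le; rewrite leq_mul2r leqnSn orbT.
case: (ltnP i 2) (ltnP j 2) => [i2|i2] [j2|j2].
- move=> Hx Hy; have := HH _ _ Hx Hy; case: ifP => [_|]; first exact: LH.
  move=> /negbT; rewrite -leqNgt => ij2; suff -> : i + j = 2 by [].
  by apply/eqP; rewrite eqn_leq ij2 andbT (leq_add (i2 : i <= 1) (j2 : j <= 1)).
- move=> Hx jy; rewrite ltnNge (leq_trans j2 (leq_addl _ _)) /=.
  by apply: lcs_le (HL _ _ _ Hx jy); rewrite leq_mul2r -add1n leq_add2r (i2 : i <= 1) orbT.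
- move=> ix Hy; rewrite ltnNge (leq_trans i2 (leq_addr _ _)) /=.
  apply: (commN (lcs_sub _)).
  by apply: lcs_le (HL _ _ _ Hy ix); rewrite leq_mul2r -addn1 leq_add2l (j2 : j <= 1) orbT.
move=> ix jy; rewrite ltnNge (leq_trans i2 (leq_addr _ _)) /=.
by apply: lcs_le (lcs_comm ix jy); rewrite mulnDl leqnSn.
Qed.

Lemma lcs_power_mem N k n : is_normal N -> 0 < k ->
  (forall u y, lcs k.-1 u -> N [~ u ^+ n, y]) ->
  (forall i c, 1 < i <= n -> lcs (i * k) c -> N (c ^+ 'C(n, i))) ->
  forall v, lcs k v -> N (v ^+ n).
Proof.
move=> nN k0 cN HN; have sN := normal_sub nN.
have HP u x y : lcs k.-1 u -> power_filtration k u 1 x ->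
    power_filtration k u 1 y -> N ((y ^+ n)^-1 * (x ^+ n)^-1 * (x * y) ^+ n).
  move=> ku Hx Hy; have filt := power_filtrationP k0 ku.
  apply: (Hall_Petrescu_mem filt) => // i c i1n.
  have /andP [i1 _] := i1n.
  by rewrite /power_filtration ltnNge i1 /=; apply: HN.
have kP u x : lcs k x -> power_filtration k u 1 x.
  by move=> kx; apply: gen_base; right.
(* Once these elements form a subgroup, only the generators [u, y] of [lcs k] remain; for them u
   [u, y] = u^y. *)
pose H v := lcs k v /\ N (v ^+ n).
suff sH : is_subgroup H.
  move=> w kw; suff [] : H w by [].
  move: kw; rewrite -{1}(prednK k0); apply: (gen_min sH) => _ [u [y [ku [_ ->]]]].
  rewrite fg_commE; have kuy := lcs_commr y ku; rewrite prednK // in kuy.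
  split=> //; set v := [~ u, y] in kuy *.
  have /HP/(_ _ (kP u v kuy)) : lcs k.-1 u by [].
  have Pu : power_filtration k u 1 u by apply: gen_base; left.
  move=> /(_ u Pu); have -> : u * v = u ^ y by rewrite /v commgEl mulVKg.
  rewrite -conjXg -mulgA -commgEl => Nv.
  have -> : v ^+ n = [~ u ^+ n, y] * ((v ^+ n)^-1 * [~ u ^+ n, y])^-1.
    by rewrite invgM invgK mulVKg.
  by apply: (subM sN); [apply: cN | apply: (subV sN)].
split=> [|x y [kx Nx] [ky Ny]|x [kx Nx]].
- by split; [apply: (sub1 (lcs_sub k)) | rewrite expg1n; apply: (sub1 sN)].
- split; first exact: (subM (lcs_sub k)).
  have Nxy := HP 1 x y (sub1 (lcs_sub _)) (kP _ _ kx) (kP _ _ ky).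
  set z := (_ * _) ^+ n in Nxy *.
  have -> : z = x ^+ n * y ^+ n * ((y ^+ n)^-1 * (x ^+ n)^-1 * z) by group_word.
  by apply: (subM sN) => //; apply: (subM sN).
split; first exact: (subV (lcs_sub k)).
by rewrite expVgn; apply: (subV sN).
Qed.

(** * Prime powers and binomial coefficients *)

(** Cancel i in i C(p^m, i) = p^m C(p^m - 1, i - 1). *)
Lemma dvdn_bin_coprime p m i :
  coprime p i -> 0 < i -> p ^ m %| 'C(p ^ m, i).
Proof.
case: i => // i pi _; rewrite -(@Gauss_dvdr _ i.+1) ?coprimeXl //.
by rewrite -mul_bin_diag dvdn_mulr.
Qed.

(** Same identity: p divides i at most once when 0 < i < p^2, so at most one factor p is lost. *)
Lemma dvdn_bin_lt_sqr p m i : prime p -> 0 < i < p ^ 2 ->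
  p ^ m %| 'C(p ^ m.+1, i).
Proof.
move=> pp /andP [i0 ip2]; have p0 := prime_gt0 pp.
have [pi|] := boolP (p %| i); last first.
  rewrite -prime_coprime // => pi; apply: dvdn_trans (dvdn_bin_coprime _ pi i0).
  by rewrite dvdn_exp2l.
have /dvdnP [j ej] := pi; rewrite ej in i0 ip2 *.
have j0 : 0 < j by move: i0; rewrite muln_gt0 => /andP [].
have jp : coprime (p ^ m) j.
  rewrite coprimeXl // prime_coprime // gtnNdvd //.
  by rewrite -(ltn_pmul2r p0).
rewrite -(Gauss_dvdr _ jp) -(dvdn_pmul2l p0) mulnA [(p * j)%N]mulnC -expnS.
by case: (j * p)%N i0 => // l _; rewrite -mul_bin_diag dvdn_mulr.
Qed.

(** * The subgroups R and [F, R] *)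

Lemma Rrel_sub q c : is_subgroup (Rrel q c).
Proof. exact: gen_sub. Qed.

Lemma Rrel_pow q c x : Rrel q c (x ^+ q).
Proof. by apply: gen_base; left; exists x; rewrite fg_powE. Qed.

Lemma Rrel_normal q c : is_normal (Rrel q c).
Proof.
split=> [|x y]; first exact: gen_sub.
elim=> {x} [x [[z ->]|cx]||x _ IH|x z _ IHx _ IHz].
- by rewrite fg_powE conjXg; apply: Rrel_pow.
- by apply: gen_base; right; apply: normalJ cx; apply: lcs_normal.
- by rewrite conj1g; apply: gen_one.
- by rewrite conjVg; apply: gen_inv.
by rewrite conjMg; apply: gen_mul.
Qed.

Lemma comm_Rrel_normal q c : is_normal (commsub fullF (Rrel q c)).
Proof. by apply: commsub_normal => //; apply: normalJ; apply: Rrel_normal. Qed.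

Lemma comm_Rrel_mem q c x y : Rrel q c x -> commsub fullF (Rrel q c) [~ x, y].
Proof.
move=> Rx; apply: (commN (normal_sub (comm_Rrel_normal q c))).
exact: commsub_mem.
Qed.

Lemma lcs_comm_Rrel q c x : lcs c.+1 x -> commsub fullF (Rrel q c) x.
Proof.
apply: gen_min (normal_sub (comm_Rrel_normal q c)) _ _.
move=> _ [h [k [ch [_ ->]]]]; rewrite fg_commE; apply: comm_Rrel_mem.
by apply: gen_base; right.
Qed.

(** R/[F, R] is abelian, so powers are multiplicative there; this is the Hall-Petrescu formula for
    the filtration R, R, [F, R], [F, R], ... *)
Lemma Rrel_expM_mem q c x y n :
  Rrel q c x -> Rrel q c y ->
  commsub fullF (Rrel q c) ((y ^+ n)^-1 * (x ^+ n)^-1 * (x * y) ^+ n).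
Proof.
have sN := normal_sub (comm_Rrel_normal q c).
pose N := commsub fullF (Rrel q c); pose F i := if i < 2 then Rrel q c else N.
have NR z : N z -> Rrel q c z.
  apply: gen_min (Rrel_sub q c) _ z => _ [h [k [_ [Rk ->]]]]; rewrite fg_commE.
  by apply: (commN (Rrel_sub q c)); apply: normalR Rk; apply: Rrel_normal.
have FR i z : F i z -> Rrel q c z by rewrite /F; case: ifP => // _; apply: NR.
have filtF : is_filtration F.
  split=> [i|[|[|i]] z|i j z t /FR Rz _] //.
  - by rewrite /F; case: ifP => _; [apply: Rrel_sub | apply: sN].
  - exact: NR.
  have := comm_Rrel_mem t Rz; rewrite /F; case: ifP => // _; exact: NR.
move=> Rx Ry; apply: (Hall_Petrescu_mem filtF) => // i z /andP [i1 _].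
by rewrite /F ltnNge i1 /= => Nz; apply: subX.
Qed.

(** * Powers modulo [F, R] *)

Section PrimePower.

Variables p m : nat.
Hypothesis p_pr : prime p.
Let q := (p ^ m)%N.
Let c := (p ^ 2 - p - 1)%N.
Let N := commsub fullF (Rrel q c).

Let p0 : 0 < p := prime_gt0 p_pr.
Let p1 : 1 < p := prime_gt1 p_pr.
Let nN : is_normal N := comm_Rrel_normal q c.
Let sN : is_subgroup N := normal_sub nN.

(** Hence [F, R] contains [lcs (p * p.-1)], that is gamma_(p(p-1)+1). *)
Lemma classE : c.+1 = (p * p.-1)%N.
Proof.
have e : (p ^ 2 - p = p * p.-1)%N by rewrite -subn1 mulnBr muln1 mulnn.
by rewrite /c e subn1 prednK // muln_gt0 p0 -ltnS prednK.
Qed.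

Lemma lcs_big k x : p * p.-1 <= k -> lcs k x -> N x.
Proof.
by move=> pk kx; apply: lcs_comm_Rrel; rewrite classE; apply: lcs_le kx.
Qed.

Lemma mem_dvd n d x : n %| d -> N (x ^+ n) -> N (x ^+ d).
Proof. by move=> /dvdnP [e ->] Nx; rewrite mulnC expgnA; apply: subX. Qed.

Lemma coprime_lt i : 0 < i < p -> coprime p i.
Proof. by move=> /andP [i0 ip]; rewrite prime_coprime // gtnNdvd. Qed.

Lemma lcs_expq k v : p.-1 <= k -> lcs k v -> N (v ^+ q).
Proof.
have [d] : exists d, p * p.-1 <= k + d by exists (p * p.-1)%N; apply: leq_addl.
elim: d k v => [|d IH] k v kd pk.
  by rewrite addn0 in kd => kv; apply: subX => //; apply: lcs_big kv.
have k0 : 0 < k by apply: leq_trans pk; rewrite -ltnS prednK.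
apply: lcs_power_mem => // [u y _|i x /andP [i1 iq] ix].
  by apply: comm_Rrel_mem; apply: Rrel_pow.
have i0 := ltnW i1.
case: (ltnP i p) => [ip|pi].
  apply: (@mem_dvd q); first by apply: dvdn_bin_coprime => //; rewrite coprime_lt // i0.
  have kik : k.+1 <= i * k.
    by apply: leq_trans (leq_mul i1 (leqnn k)); rewrite mul2n -addnn -add1n leq_add2r.
  by apply: IH (lcs_le kik ix); [rewrite addSnnS | apply: leqW].
(* The bound i k >= p (p - 1) is attained at i = p, k = p - 1. *)
by apply: subX => //; apply: lcs_big ix; apply: leq_mul.
Qed.

(** For i < p the binomial is divisible by pq and the weight has grown; for p <= i < p^2 it is
    divisible by q, enough for [lcs_expq]; from p^2 on the weight alone suffices. *)
Lemma bin_pq_mem k i x : 0 < k -> 1 < i ->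
  (forall y, lcs k.+1 y -> N (y ^+ (p * q))) ->
  lcs (i * k) x -> N (x ^+ 'C(p * q, i)).
Proof.
move=> k0 i1 IH ix; have i0 := ltnW i1; rewrite /q -expnS.
case: (ltnP i p) => [ip|pi].
  apply: (@mem_dvd (p ^ m.+1)).
    by apply: dvdn_bin_coprime => //; rewrite coprime_lt // i0.
  rewrite expnS; apply: IH; apply: lcs_le ix.
  by apply: leq_trans (leq_mul i1 (leqnn k)); rewrite mul2n -addnn -add1n leq_add2r.
have iik : i <= i * k by rewrite leq_pmulr.
case: (ltnP i (p ^ 2)) => [ip2|p2i].
  apply: (@mem_dvd q); first by apply: dvdn_bin_lt_sqr => //; rewrite i0.
  apply: lcs_expq ix; apply: leq_trans (leq_pred p) _; exact: leq_trans iik.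
apply: subX => //; apply: lcs_big ix; apply: leq_trans (leq_trans p2i iik).
by rewrite -mulnn leq_mul2l leq_pred orbT.
Qed.

Lemma lcs_exppq k v : 0 < k -> lcs k v -> N (v ^+ (p * q)).
Proof.
have [d] : exists d, p * p.-1 <= k + d by exists (p * p.-1)%N; apply: leq_addl.
elim: d k v => [|d IH] k v kd k0.
  by rewrite addn0 in kd => kv; apply: subX => //; apply: lcs_big kv.
apply: lcs_power_mem => // [u y _|i x /andP [i1 _] ix].
  by apply: comm_Rrel_mem; rewrite expgnA; apply: Rrel_pow.
by apply: (bin_pq_mem k0) ix => // y; apply: IH => //; rewrite addSnnS.
Qed.

Lemma expMpq_mem x y :
  N ((y ^+ (p * q))^-1 * (x ^+ (p * q))^-1 * (x * y) ^+ (p * q)).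
Proof.
apply: (Hall_Petrescu_mem lcs_filtration) => // i z /andP [i1 _] iz.
have i0 := ltnW i1.
case: (ltnP i p) => [ip|pi].
  apply: (@mem_dvd (p * q)).
    by rewrite /q -expnS; apply: dvdn_bin_coprime => //; rewrite coprime_lt // i0.
  by apply: lcs_exppq iz; rewrite -ltnS prednK.
case: (ltnP i (p ^ 2)) => [ip2|p2i].
  apply: (@mem_dvd q).
    by rewrite {2}/q -expnS; apply: dvdn_bin_lt_sqr => //; rewrite i0.
  by apply: lcs_expq iz; rewrite -ltnS !prednK.
apply: subX => //; apply: lcs_big iz; rewrite -ltnS prednK //.
by apply: leq_trans p2i; rewrite -mulnn ltn_pmul2l // prednK.
Qed.

End PrimePower.

Local Close Scope group_scope.

(* The class of w[F,R] in M(R(2,q;c)) = (R ∩ F')/[F,R], c = p^2-p-1, has order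
   dividing p: w lies in R ∩ F' and w^p lies in [F, R]. *)
Theorem theorem4 (p q : nat) :
  prime p -> (exists k, 0 < k /\ q = p ^ k) ->
  let c := p ^ 2 - p - 1 in
  Rrel q c (w_elt q) /\ derF (w_elt q) /\
  commsub fullF (Rrel q c) (fg_pow (w_elt q) p).
Proof.
move=> pp [m [_ ->]] {q} c; set q := p ^ m; set a := gen_a; set b := gen_b.
have wE : w_elt q = ((b ^+ q)^-1 * (a ^+ q)^-1 * (a * b) ^+ q)%g.
  by rewrite /w_elt !fg_powE.
have Rq x : Rrel q c (x ^+ q)%g by apply: Rrel_pow.
have RqV x : Rrel q c (x ^+ q)^-1%g by apply: (subV (Rrel_sub q c)).
rewrite wE; split; first by do 2!apply: (subM (Rrel_sub q c)) => //.
split.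
  (* Apply the formula with N = F', which is [lcs 1] and contains every c_i with i > 1. *)
  apply: (Hall_Petrescu_mem lcs_filtration) => [|//|//|i z /andP [i1 _] iz].
    exact: (lcs_sub 1).
  apply: subX; first exact: (lcs_sub 1).
  by apply: (@lcs_le 1 i.-1) iz; rewrite -ltnS prednK // ltnW.
rewrite fg_powE; have sN := normal_sub (comm_Rrel_normal q c).
have RbaV : Rrel q c ((b ^+ q)^-1 * (a ^+ q)^-1)%g.
  exact: (subM (Rrel_sub q c)).
(* Modulo [F, R], [w1] and [w2] distribute the p-th power over the three factors of w, and [w3]
   compares (ab)^(pq) with a^(pq) b^(pq). *)
have w1 := Rrel_expM_mem p RbaV (Rq (a * b)%g).
have w2 := Rrel_expM_mem p (RqV b) (RqV a).
have w3 := expMpq_mem m pp a b.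
rewrite mulnC !expgnA -/q in w3; rewrite !expVgn !invgK in w2.
set W := (X in commsub _ _ X); set Y := ((a * b) ^+ q ^+ p)%g in w1 w3.
(* The product of [w3], the conjugate of [w2] by [Y], and [w1] telescopes to w^p. *)
have -> : W = ((b ^+ q ^+ p)^-1 * (a ^+ q ^+ p)^-1 * Y
  * (a ^+ q ^+ p * b ^+ q ^+ p * ((b ^+ q)^-1 * (a ^+ q)^-1) ^+ p) ^ Y
  * (Y^-1 * (((b ^+ q)^-1 * (a ^+ q)^-1) ^+ p)^-1 * W))%g by group_word.
apply: (subM sN) => //; apply: (subM sN) => //.
exact: (normalJ (comm_Rrel_normal q c)).
Qed.
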